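(* Let $(a_n)_{n\geq 0}$ be the Thue–Morse sequence and, for an integer $b\geq2$, let $\xi_b=\sum_{n=0}^{+\infty}a_n/b^n$. Then for every integer $b\geq 2$, the irrationality measure of $\xi_b$ satisfies $\mu(\xi_b)\leq 5$.
   Context: The Thue–Morse sequence $(a_n)_{n\geq0}$ is defined by $a_n=0$ if the sum of the binary digits of $n$ is even and $a_n=1$ otherwise; it is the fixed point beginning with $0$ of the morphism $0\mapsto 01$, $1\mapsto 10$. The irrationality measure $\mu(\xi)$ is the supremum of the real $\tau>0$ for which $|\xi-p/q|<q^{-\tau}$ has infinitely many solutions with $p,q$ coprime integers. *)

(* Defs.v *)
From Stdlib Require Import Reals ZArith Arith List.
From Stdlib Require Ensembles Finite_sets.
From Coquelicot Require Import Coquelicot.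
Open Scope R_scope.

(* The binary digits of n at positions i >= n all vanish, since n < 2 ^ n. *)
Definition binary_digit_sum (n : nat) : nat :=
  list_sum (map (fun i => Nat.b2n (Nat.testbit n i)) (seq 0 n)).

Definition thue_morse (n : nat) : nat :=
  if Nat.even (binary_digit_sum n) then 0%nat else 1%nat.

Definition thue_morse_number (b : Z) : R :=
  Series (fun n => INR (thue_morse n) / IZR b ^ n).

(* The sign of a fraction p/q is carried by p: denominators are positive. *)
Definition approximations (xi tau : R) : Ensembles.Ensemble (Z * Z) :=
  fun '(p, q) =>
    (0 < q)%Z /\ Z.gcd p q = 1%Z /\
    Rabs (xi - IZR p / IZR q) < Rpower (IZR q) (- tau).

(* The supremum is taken in Rbar, so it may be infinite. *)
Definition irrationality_measure (xi : R) : Rbar :=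
  Lub_Rbar (fun tau =>
    0 < tau /\ ~ Finite_sets.Finite (Z * Z) (approximations xi tau)).

(* Main.v *)
(* Let f(x) be the power series with coefficients (-1)^(a_n), so that
   f(x) = (1 - x) f(x^2) and xi_b is an affine function of f(1/b) with rational
   coefficients. Put D = b^(2^n). Iterating the functional equation gives
   f(1/b) = P f(1/D) with P a fraction of denominator D/b, bounded away from 0;
   replacing f(y) by 1/(1 + y) at y = 1/D yields a fraction of denominator D + 1
   whose distance to f(1/b) is of exact order D^(-2). Since consecutive values
   of D are D and D^2, for each s some D lies between 48 s and a constant times
   s^2. Comparing r/s with the corresponding approximation gives
   |f(1/b) - r/s| >= c s^(-4), whether or not the two fractions coincide. *)
Require Import Defs.
From Stdlib Require Import Reals ZArith.
From Coquelicot Require Import Coquelicot.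
From Stdlib Require Import Lia Lra List.
From Stdlib Require Import Classical FunctionalExtensionality PropExtensionality.
Open Scope R_scope.

(** * Binary digit sums under doubling *)

(** Separates the number of positions read from [n], so that the lowest digit can be split off while
    the range shrinks by one. *)
Definition digit_sum_below (m n : nat) : nat :=
  list_sum (map (fun i => Nat.b2n (Nat.testbit n i)) (seq 0 m)).

Lemma digit_sum_below_S (m n : nat) :
  digit_sum_below (S m) n =
  (Nat.b2n (Nat.testbit n 0) + digit_sum_below m (Nat.div2 n))%nat.
Proof.
  unfold digit_sum_below; cbn [seq map list_sum fold_right].
  rewrite <- seq_shift, map_map. reflexivity.
Qed.

Lemma digit_sum_below_large (m n : nat) :
  (n <= m)%nat -> digit_sum_below m n = binary_digit_sum n.
Proof.
  intros Hnm; induction Hnm as [|m Hnm IH]; [reflexivity|].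
  rewrite <- IH; unfold digit_sum_below.
  rewrite seq_S, map_app, list_sum_app; simpl.
  replace (Nat.testbit n m) with false; [simpl; lia|].
  symmetry; destruct n as [|n]; [apply Nat.bits_0|].
  apply Nat.bits_above_log2.
  apply Nat.lt_le_trans with (S n); [apply Nat.log2_lt_lin; lia | lia].
Qed.

Lemma binary_digit_sum_double (n : nat) :
  binary_digit_sum (2 * n) = binary_digit_sum n.
Proof.
  rewrite <- (digit_sum_below_large (S (2 * n))) by lia.
  rewrite digit_sum_below_S, Nat.testbit_even_0, Nat.div2_double.
  apply digit_sum_below_large; lia.
Qed.

Lemma binary_digit_sum_succ_double (n : nat) :
  binary_digit_sum (2 * n + 1) = S (binary_digit_sum n).
Proof.
  rewrite <- (digit_sum_below_large (S (2 * n))) by lia.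
  rewrite digit_sum_below_S, Nat.testbit_odd_0.
  replace (2 * n + 1)%nat with (S (2 * n)) by lia.
  rewrite Nat.div2_succ_double.
  rewrite digit_sum_below_large by lia; reflexivity.
Qed.

(** * The signed series and its functional equation *)

Definition thue_morse_sign (n : nat) : R := 1 - 2 * INR (thue_morse n).

Lemma thue_morse_sign_double (n : nat) :
  thue_morse_sign (2 * n) = thue_morse_sign n.
Proof.
  unfold thue_morse_sign, thue_morse; now rewrite binary_digit_sum_double.
Qed.

Lemma thue_morse_sign_succ_double (n : nat) :
  thue_morse_sign (2 * n + 1) = - thue_morse_sign n.
Proof.
  unfold thue_morse_sign, thue_morse.
  rewrite binary_digit_sum_succ_double, Nat.even_succ, <- Nat.negb_even.
  destruct (Nat.even (binary_digit_sum n)); simpl; lra.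
Qed.

Lemma Rabs_thue_morse_sign (n : nat) : Rabs (thue_morse_sign n) = 1.
Proof.
  unfold thue_morse_sign, thue_morse.
  destruct (Nat.even _); simpl;
    [rewrite Rabs_right | rewrite Rabs_left]; lra.
Qed.

Definition thue_morse_series (x : R) : R :=
  Series (fun n => thue_morse_sign n * x ^ n).

Lemma Rabs_thue_morse_term (x : R) (n : nat) :
  0 <= x -> Rabs (thue_morse_sign n * x ^ n) = x ^ n.
Proof.
  intros Hx; rewrite Rabs_mult, Rabs_thue_morse_sign, Rmult_1_l.
  apply Rabs_right, Rle_ge, pow_le, Hx.
Qed.

Lemma ex_series_geom_unit (x : R) : 0 <= x < 1 -> ex_series (fun n => x ^ n).
Proof. intros Hx; apply ex_series_geom; rewrite Rabs_right; lra. Qed.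

Lemma Series_geom_unit (x : R) : 0 <= x < 1 -> Series (fun n => x ^ n) = / (1 - x).
Proof. intros Hx; apply Series_geom; rewrite Rabs_right; lra. Qed.

Lemma ex_thue_morse_series_abs (x : R) :
  0 <= x < 1 -> ex_series (fun n => Rabs (thue_morse_sign n * x ^ n)).
Proof.
  intros Hx; apply ex_series_ext with (fun n => x ^ n).
  - intros n; symmetry; apply Rabs_thue_morse_term; lra.
  - now apply ex_series_geom_unit.
Qed.

Lemma ex_thue_morse_series (x : R) :
  0 <= x < 1 -> ex_series (fun n => thue_morse_sign n * x ^ n).
Proof. intros Hx; now apply ex_series_Rabs, ex_thue_morse_series_abs. Qed.

(** The terms of index [2 * k] and [2 * k + 1] have opposite signs, so each pair contributes a
    factor [1 - x]. *)
Lemma sum_n_thue_morse_double (x : R) (N : nat) :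
  sum_n (fun n => thue_morse_sign n * x ^ n) (2 * N + 1) =
  (1 - x) * sum_n (fun n => thue_morse_sign n * (x ^ 2) ^ n) N.
Proof.
  assert (HS : forall (u : nat -> R) n, sum_n u (S n) = sum_n u n + u (S n))
    by exact (fun u n => sum_Sn u n).
  assert (Hpair : forall k, thue_morse_sign (2 * k) * x ^ (2 * k) +
      thue_morse_sign (2 * k + 1) * x ^ (2 * k + 1) =
      (1 - x) * (thue_morse_sign k * (x ^ 2) ^ k)).
  { intros k.
    rewrite thue_morse_sign_double, thue_morse_sign_succ_double.
    rewrite pow_add, pow_mult; ring. }
  induction N as [|N IH].
  - change (2 * 0 + 1)%nat with 1%nat.
    rewrite HS, !sum_O; exact (Hpair 0%nat).
  - replace (2 * S N + 1)%nat with (S (S (2 * N + 1))) by lia.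
    rewrite !HS, IH.
    replace (S (S (2 * N + 1))) with (2 * S N + 1)%nat by lia.
    replace (S (2 * N + 1)) with (2 * S N)%nat by lia.
    rewrite Rplus_assoc, Hpair; symmetry; apply Rmult_plus_distr_l.
Qed.

Lemma pow2_unit (x : R) : 0 <= x < 1 -> 0 <= x ^ 2 < 1.
Proof. intros Hx; nra. Qed.

Lemma thue_morse_series_square (x : R) :
  0 <= x < 1 -> thue_morse_series x = (1 - x) * thue_morse_series (x ^ 2).
Proof.
  intros Hx.
  pose proof (Series_correct _ (ex_thue_morse_series x Hx)) as H1.
  pose proof (Series_correct _ (ex_thue_morse_series _ (pow2_unit x Hx))) as H2.
  (* Since the series converges, its partial sums of odd index have the same limit. *)
  assert (L1 : is_lim_seq
    (fun N => sum_n (fun n => thue_morse_sign n * x ^ n) (2 * N + 1))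
    (thue_morse_series x)).
  { apply (is_lim_seq_subseq
      (sum_n (fun n => thue_morse_sign n * x ^ n)) _ (fun N => (2 * N + 1)%nat)).
    - apply eventually_subseq; intros n; lia.
    - exact H1. }
  assert (L2 : is_lim_seq
    (fun N => (1 - x) * sum_n (fun n => thue_morse_sign n * (x ^ 2) ^ n) N)
    ((1 - x) * thue_morse_series (x ^ 2))).
  { apply (is_lim_seq_scal_l _ (1 - x) (Finite _)); exact H2. }
  apply is_lim_seq_unique in L1; apply is_lim_seq_unique in L2.
  rewrite (Lim_seq_ext _ _ (sum_n_thue_morse_double x)), L2 in L1.
  now injection L1.
Qed.

(** * Bounds on the series *)

Lemma Rabs_thue_morse_series_le (x : R) :
  0 <= x < 1 -> Rabs (thue_morse_series x) <= / (1 - x).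
Proof.
  intros Hx; unfold thue_morse_series.
  rewrite <- Series_geom_unit by exact Hx.
  eapply Rle_trans; [now apply Series_Rabs, ex_thue_morse_series_abs|].
  apply Req_le, Series_ext; intros n; apply Rabs_thue_morse_term; lra.
Qed.

(** The functional equation improves the geometric bound [/ (1 - x)] to
    [(1 - x) / (1 - x ^ 2) = / (1 + x)]. *)
Lemma thue_morse_series_le_1 (x : R) : 0 <= x < 1 -> thue_morse_series x <= 1.
Proof.
  intros Hx; rewrite thue_morse_series_square by exact Hx.
  pose proof (Rabs_thue_morse_series_le _ (pow2_unit x Hx)) as H.
  pose proof (Rle_abs (thue_morse_series (x ^ 2))) as H'.
  assert (E : (1 - x) * / (1 - x ^ 2) = / (1 + x)) by (field; nra).
  assert (/ (1 + x) <= 1) by (rewrite <- Rinv_1; apply Rinv_le_contravar; lra).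
  nra.
Qed.

(** The constant term is 1, and the remaining terms are at most [x / (1 - x) <= 2 * x] in absolute
    value. *)
Lemma thue_morse_series_ge (x : R) :
  0 <= x <= 1 / 2 -> 1 - 2 * x <= thue_morse_series x.
Proof.
  intros Hx; unfold thue_morse_series.
  assert (Hx1 : 0 <= x < 1) by lra.
  rewrite Series_incr_1 by now apply ex_thue_morse_series.
  set (T := Series _).
  assert (HT : Rabs T <= / (1 - x) - 1).
  { unfold T; eapply Rle_trans.
    - apply Series_Rabs.
      apply (ex_series_incr_1 (fun n => Rabs (thue_morse_sign n * x ^ n))).
      now apply ex_thue_morse_series_abs.
    - rewrite <- Series_geom_unit by exact Hx1.
      rewrite (Series_incr_1 (fun n => x ^ n)) by now apply ex_series_geom_unit.
      apply Req_le; rewrite pow_O.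
      rewrite (Series_ext _ (fun n => x ^ S n)); [ring|].
      intros n; apply Rabs_thue_morse_term; lra. }
  assert (Hinv : / (1 - x) <= 1 + 2 * x).
  { apply Rmult_le_reg_l with (1 - x); [lra|]. rewrite Rinv_r by lra. nra. }
  replace (thue_morse_sign 0 * x ^ 0) with 1
    by (unfold thue_morse_sign; simpl; ring).
  apply Rabs_le_between in HT; lra.
Qed.

(** The linear bound degenerates at [x = 1 / 2]; one use of the functional equation moves the
    argument to [x ^ 2 <= 1 / 4], where both factors are at least 1/2. *)
Lemma thue_morse_series_ge_quarter (x : R) :
  0 <= x <= 1 / 2 -> 1 / 4 <= thue_morse_series x.
Proof.
  intros Hx; rewrite thue_morse_series_square by lra.
  assert (1 - 2 * x ^ 2 <= thue_morse_series (x ^ 2))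
    by (apply thue_morse_series_ge; nra).
  assert (1 / 2 <= thue_morse_series (x ^ 2)) by nra.
  nra.
Qed.

(* [1 / (1 + y)] is the [0/1] Padé approximant of the series; the order of
   contact is exactly two because [(1 + y) f(y) = (1 - y^2) f(y^2)]. *)
Lemma thue_morse_series_pade (y : R) :
  0 <= y <= 1 / 2 ->
  y ^ 2 <= 1 - (1 + y) * thue_morse_series y <= 3 * y ^ 2.
Proof.
  intros Hy.
  assert (Hz : 0 <= y ^ 2 <= 1 / 4) by nra.
  assert (E : (1 + y) * thue_morse_series y = (1 - y ^ 2) * thue_morse_series (y ^ 2)).
  { rewrite (thue_morse_series_square y) by lra. ring. }
  rewrite E.
  assert (thue_morse_series (y ^ 2) <= 1) by (apply thue_morse_series_le_1; lra).
  assert (1 - 2 * y ^ 2 <= thue_morse_series (y ^ 2))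
    by (apply thue_morse_series_ge; lra).
  split; nra.
Qed.

(** * Approximations from repeated squaring *)

Fixpoint iterated_square (b : Z) (n : nat) : Z :=
  match n with
  | O => b
  | S m => iterated_square b m ^ 2
  end%Z.

(** Collects the numerators of the factors [1 - / D], with [D] running over the first [n] iterated
    squares; the denominators multiply to [iterated_square b n / b]. *)
Fixpoint pred_product (b : Z) (n : nat) : Z :=
  match n with
  | O => 1
  | S m => pred_product b m * (iterated_square b m - 1)
  end%Z.

Lemma iterated_square_ge (b : Z) (n : nat) :
  (2 <= b)%Z -> (b <= iterated_square b n)%Z.
Proof. intros Hb; induction n as [|n IH]; cbn [iterated_square]; nia. Qed.

Lemma inv_IZR_le_half (D : Z) : (2 <= D)%Z -> 0 < / IZR D <= 1 / 2.
Proof.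
  intros HD; apply IZR_le in HD.
  split; [apply Rinv_0_lt_compat; lra|].
  unfold Rdiv; rewrite Rmult_1_l; apply Rinv_le_contravar; lra.
Qed.

Lemma thue_morse_series_iterated_square (b : Z) (n : nat) :
  (2 <= b)%Z ->
  thue_morse_series (/ IZR b) =
  IZR (b * pred_product b n) / IZR (iterated_square b n) *
  thue_morse_series (/ IZR (iterated_square b n)).
Proof.
  intros Hb; induction n as [|n IH]; cbn [iterated_square pred_product].
  - rewrite Z.mul_1_r; field; apply not_0_IZR; lia.
  - pose proof (iterated_square_ge b n Hb) as HD.
    set (D := iterated_square b n) in *.
    assert (HD2 : (2 <= D)%Z) by lia.
    pose proof (inv_IZR_le_half D HD2).
    rewrite IH, (thue_morse_series_square (/ IZR D)) by lra.
    replace (IZR (D ^ 2)) with (IZR D ^ 2) by (rewrite pow_IZR; reflexivity).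
    rewrite pow_inv, !mult_IZR, minus_IZR.
    field; apply not_0_IZR; lia.
Qed.

Lemma thue_morse_series_approx (b : Z) (n : nat) :
  (2 <= b)%Z ->
  let D := iterated_square b n in
  / (8 * IZR D ^ 2) <=
  Rabs (thue_morse_series (/ IZR b) - IZR (b * pred_product b n) / IZR (D + 1))
  <= 12 / IZR D ^ 2.
Proof.
  intros Hb D.
  pose proof (iterated_square_ge b n Hb) as HD; fold D in HD.
  assert (HD2 : (2 <= D)%Z) by lia.
  pose proof (inv_IZR_le_half D HD2) as Hy.
  pose proof (inv_IZR_le_half b Hb) as Hx.
  pose proof (thue_morse_series_iterated_square b n Hb) as HF; fold D in HF.
  assert (HDR : 2 <= IZR D) by (apply IZR_le; lia).
  rewrite plus_IZR.
  set (A := IZR (b * pred_product b n)) in *.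
  set (F := thue_morse_series (/ IZR b)) in *.
  set (d := IZR D) in *.
  set (f := thue_morse_series (/ d)) in *.
  assert (HF1 : 1 / 4 <= F) by (apply thue_morse_series_ge_quarter; lra).
  assert (HF2 : F <= 1) by (apply thue_morse_series_le_1; lra).
  assert (Hf1 : 1 / 4 <= f) by (apply thue_morse_series_ge_quarter; lra).
  assert (Hf2 : f <= 1) by (apply thue_morse_series_le_1; lra).
  pose proof (thue_morse_series_pade (/ d)) as Hp; fold f in Hp.
  set (y := / d) in *.
  set (P := A / d) in *.
  assert (Hp' : y ^ 2 <= 1 - (1 + y) * f <= 3 * y ^ 2) by (apply Hp; lra).
  (* [P] is the quotient [F / f] of two values lying in [1/4, 1]. *)
  assert (HP : 1 / 4 <= P) by nra.
  assert (HP1 : P <= 4) by nra.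
  assert (E : F - A / (d + 1) = - (P * (1 - (1 + y) * f) / (1 + y))).
  { rewrite HF; unfold P, y; field; lra. }
  rewrite E, Rabs_Ropp.
  assert (Ey : / d ^ 2 = y ^ 2) by (unfold y; now rewrite pow_inv).
  rewrite Rinv_mult; unfold Rdiv at 2; rewrite Ey.
  set (g := 1 - (1 + y) * f) in *.
  assert (Hi : 1 / 2 <= / (1 + y) <= 1).
  { split; [replace (1 / 2) with (/ 2) by lra | rewrite <- Rinv_1];
      apply Rinv_le_contravar; lra. }
  assert (Hy2 : 0 < y ^ 2) by nra.
  (* The factor [/ (1 + y)], between 1/2 and 1, then gives the constants 8 and 12. *)
  assert (HPg : y ^ 2 / 4 <= P * g <= 12 * y ^ 2) by (split; nra).
  unfold Rdiv; rewrite Rabs_right; nra.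
Qed.

(** The first iterate reaching [t] is either [b] itself or the square of a value below [t]. *)
Lemma exists_iterated_square_between (b : Z) (t : Z) :
  (2 <= b)%Z -> (1 <= t)%Z ->
  exists n, (t <= iterated_square b n <= b * t ^ 2)%Z.
Proof.
  intros Hb Ht.
  (* As long as the iterates stay below [t], each squaring adds at least 1; [k = t] rules this
     out. *)
  assert (Hinc : forall k, exists n,
    (t <= iterated_square b n <= b * t ^ 2)%Z \/ (b + Z.of_nat k <= iterated_square b n < t)%Z).
  { induction k as [|k [n [H|H]]].
    - exists 0%nat; simpl; destruct (Z_lt_le_dec b t); [right|left]; nia.
    - exists n; now left.
    - exists (S n); cbn [iterated_square].
      destruct (Z_lt_le_dec (iterated_square b n ^ 2) t); [right|left]; nia. }
  destruct (Hinc (Z.to_nat t)) as [n [H|H]]; [now exists n | lia].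
Qed.

(** * Distance to an arbitrary fraction *)

Lemma Rabs_fraction_sub_ge (r s A Q : Z) :
  (0 < s)%Z -> (0 < Q)%Z -> (r * Q <> A * s)%Z ->
  / (IZR s * IZR Q) <= Rabs (IZR r / IZR s - IZR A / IZR Q).
Proof.
  intros Hs HQ Hne.
  pose proof (IZR_lt _ _ Hs) as Hs'; pose proof (IZR_lt _ _ HQ) as HQ'.
  replace (IZR r / IZR s - IZR A / IZR Q)
    with (IZR (r * Q - A * s) * / (IZR s * IZR Q))
    by (rewrite minus_IZR, !mult_IZR; field; lra).
  assert (Hpos : 0 < / (IZR s * IZR Q)) by (apply Rinv_0_lt_compat; nra).
  rewrite Rabs_mult, (Rabs_right (/ _)) by lra.
  assert (1 <= Rabs (IZR (r * Q - A * s))).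
  { rewrite <- abs_IZR; apply IZR_le; lia. }
  nra.
Qed.

Lemma thue_morse_series_fraction (b r s : Z) :
  (2 <= b)%Z -> (0 < s)%Z ->
  / (8 * IZR b ^ 2 * 48 ^ 4 * IZR s ^ 4) <=
  Rabs (thue_morse_series (/ IZR b) - IZR r / IZR s).
Proof.
  intros Hb Hs.
  (* 48 is four times the error constant 12: one factor 2 leaves half of the gap, the other covers
     [D + 1 <= 2 * D]. *)
  destruct (exists_iterated_square_between b (48 * s)) as [n [Hn1 Hn2]]; try lia.
  destruct (thue_morse_series_approx b n Hb) as [Hlo Hhi].
  set (D := iterated_square b n) in *.
  set (A := (b * pred_product b n)%Z) in *.
  set (F := thue_morse_series (/ IZR b)) in *.
  assert (HD : (2 <= D)%Z) by (pose proof (iterated_square_ge b n Hb); lia).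
  assert (Hs1 : 1 <= IZR s) by (apply IZR_le; lia).
  assert (Hd1 : 48 * IZR s <= IZR D) by (rewrite <- mult_IZR; apply IZR_le; lia).
  assert (Hd2 : IZR D <= IZR b * (48 * IZR s) ^ 2).
  { replace (IZR b * (48 * IZR s) ^ 2) with (IZR (b * (48 * s) ^ 2)).
    - now apply IZR_le.
    - rewrite Z.pow_2_r, !mult_IZR; ring. }
  assert (HdR : 2 <= IZR D) by (apply IZR_le; lia).
  (* The upper bound on [D], quadratic in [s], turns order [D ^ (-2)] into order [s ^ (-4)]. *)
  apply Rle_trans with (/ (8 * IZR D ^ 2)).
  { apply Rinv_le_contravar; [nra|].
    replace (8 * IZR b ^ 2 * 48 ^ 4 * IZR s ^ 4)
      with (8 * (IZR b * (48 * IZR s) ^ 2) ^ 2) by ring.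
    apply Rmult_le_compat_l; [lra|]; apply pow_incr; lra. }
  (* If the fractions coincide, the lower bound on the approximation error is the claim itself;
     otherwise their gap dominates that error. *)
  destruct (Z.eq_dec (r * (D + 1)) (A * s)) as [Heq|Hne].
  - replace (IZR r / IZR s) with (IZR A / IZR (D + 1)); [exact Hlo|].
    apply (f_equal IZR) in Heq; rewrite !mult_IZR in Heq.
    assert (HD1 : IZR (D + 1) <> 0) by (apply not_0_IZR; lia).
    apply Rmult_eq_reg_r with (IZR s * IZR (D + 1)).
    + field_simplify; lra.
    + apply Rmult_integral_contrapositive; split; lra.
  - apply Rabs_fraction_sub_ge in Hne; try lia.
    rewrite plus_IZR in Hne, Hhi.
    set (d := IZR D) in *; set (x := IZR s) in *.
    assert (Htri : Rabs (IZR r / x - IZR A / (d + 1)) <=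
      Rabs (F - IZR r / x) + Rabs (F - IZR A / (d + 1))).
    { replace (IZR r / x - IZR A / (d + 1))
        with (- (F - IZR r / x) + (F - IZR A / (d + 1))) by ring.
      eapply Rle_trans; [apply Rabs_triang|]; rewrite Rabs_Ropp; lra. }
    (* Two distinct fractions are so far apart that the error [12 / d ^ 2]
       uses up at most half of the gap; this is what [d >= 48 * x] is for. *)
    assert (H24 : 24 / d ^ 2 <= / (x * (d + 1))).
    { apply Rmult_le_reg_r with (d ^ 2 * (x * (d + 1))); [apply Rmult_lt_0_compat; nra|].
      replace (24 / d ^ 2 * (d ^ 2 * (x * (d + 1)))) with (24 * (x * (d + 1)))
        by (field; lra).
      replace (/ (x * (d + 1)) * (d ^ 2 * (x * (d + 1)))) with (d ^ 2)
        by (field; lra).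
      nra. }
    rewrite Rinv_mult.
    unfold Rdiv in *.
    assert (0 < / d ^ 2) by (apply Rinv_0_lt_compat; nra).
    lra.
Qed.

(** * From the series to the Thue-Morse number *)

Lemma thue_morse_number_series (b : Z) :
  (2 <= b)%Z ->
  thue_morse_number b =
  (IZR b / IZR (b - 1) - thue_morse_series (/ IZR b)) / 2.
Proof.
  intros Hb.
  pose proof (inv_IZR_le_half b Hb) as Hx.
  assert (HbR : 2 <= IZR b) by (apply IZR_le; lia).
  assert (Hx1 : 0 <= / IZR b < 1) by lra.
  unfold thue_morse_number, thue_morse_series.
  replace (IZR b / IZR (b - 1)) with (/ (1 - / IZR b))
    by (rewrite minus_IZR; field; lra).
  rewrite <- Series_geom_unit by exact Hx1.
  rewrite <- Series_minus
    by (now apply ex_series_geom_unit || now apply ex_thue_morse_series).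
  unfold Rdiv at 2; rewrite <- Series_scal_r.
  apply Series_ext; intros n; unfold thue_morse_sign.
  rewrite pow_inv; field.
  apply pow_nonzero; lra.
Qed.

Lemma thue_morse_number_fraction (b : Z) :
  (2 <= b)%Z ->
  exists C, 0 < C /\ forall p q, (0 < q)%Z ->
    / (C * IZR q ^ 4) <= Rabs (thue_morse_number b - IZR p / IZR q).
Proof.
  intros Hb.
  assert (HbR : 2 <= IZR b) by (apply IZR_le; lia).
  exists (2 * (8 * IZR b ^ 2 * 48 ^ 4 * IZR (b - 1) ^ 4)).
  rewrite minus_IZR.
  assert (Hpos : 0 < IZR b ^ 2 * (IZR b - 1) ^ 4)
    by (apply Rmult_lt_0_compat; apply pow_lt; lra).
  split; [nra|].
  intros p q Hq.
  pose proof (IZR_lt _ _ Hq) as HqR.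
  rewrite thue_morse_number_series by exact Hb.
  (* This fraction is [b / (b - 1) - 2 * p / q], the image of [p / q] under the affine relation; its
     denominator accounts for [(b - 1) ^ 4] in the constant. *)
  pose proof (thue_morse_series_fraction b (b * q - 2 * p * (b - 1)) ((b - 1) * q) Hb) as H.
  set (F := thue_morse_series (/ IZR b)) in *.
  rewrite minus_IZR, !mult_IZR, minus_IZR in H.
  rewrite minus_IZR.
  replace ((IZR b / (IZR b - 1) - F) / 2 - IZR p / IZR q) with
    (- (1 / 2) * (F - (IZR b * IZR q - 2 * IZR p * (IZR b - 1)) /
      ((IZR b - 1) * IZR q))) by (field; lra).
  rewrite Rabs_mult, Rabs_Ropp, (Rabs_right (1 / 2)) by lra.
  replace (2 * (8 * IZR b ^ 2 * 48 ^ 4 * (IZR b - 1) ^ 4) * IZR q ^ 4)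
    with (2 * (8 * IZR b ^ 2 * 48 ^ 4 * ((IZR b - 1) * IZR q) ^ 4)) by ring.
  rewrite Rinv_mult.
  specialize (H ltac:(nia)); lra.
Qed.

(** * Finiteness of bounded sets, and the irrationality measure *)

Lemma ensemble_ext (T : Type) (U V : Ensembles.Ensemble T) :
  (forall x, U x <-> V x) -> U = V.
Proof.
  intros H; apply functional_extensionality; intros x.
  apply propositional_extensionality, H.
Qed.

(** Induction on the list: whether its head belongs to [U] is decided classically, and if so the
    head is removed from [U] and added back. *)
Lemma Finite_incl_list (T : Type) (l : list T) (U : Ensembles.Ensemble T) :
  (forall x, U x -> In x l) -> Finite_sets.Finite T U.
Proof.
  revert U; induction l as [|a l IH]; intros U HU.
  - replace U with (Ensembles.Empty_set T); [constructor|].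
    apply ensemble_ext; intros x; split; [intros [] | intros Hx; destruct (HU x Hx)].
  - destruct (classic (U a)) as [Ha|Ha].
    + replace U with (Ensembles.Add T (fun x => U x /\ x <> a) a).
      * constructor; [|now intros [_ Hne]].
        apply IH; intros x [Hx Hne].
        destruct (HU x Hx) as [Hax|Hl]; [now destruct Hne | exact Hl].
      * apply ensemble_ext; intros x; split.
        -- intros [y [Hy _]|y Hy]; [exact Hy | now destruct Hy].
        -- intros Hx; destruct (classic (x = a)) as [->|Hne];
             [right; constructor | now left].
    + apply IH; intros x Hx.
      destruct (HU x Hx) as [Hax|Hl]; [|exact Hl].
      now rewrite Hax in Ha.
Qed.

Lemma Finite_bounded_pairs (M : Z) (U : Ensembles.Ensemble (Z * Z)) :
  (forall p q, U (p, q) -> (Z.abs p <= M /\ Z.abs q <= M)%Z) ->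
  Finite_sets.Finite (Z * Z) U.
Proof.
  intros HU.
  set (l := map (fun k => Z.of_nat k - M)%Z (seq 0 (Z.to_nat (2 * M + 1)))).
  assert (Hl : forall z, (Z.abs z <= M)%Z -> In z l).
  { intros z Hz; apply in_map_iff; exists (Z.to_nat (z + M)).
    rewrite in_seq; split; lia. }
  apply Finite_incl_list with (list_prod l l).
  intros [p q] H; destruct (HU p q H) as [Hp Hq].
  apply in_prod; now apply Hl.
Qed.

Theorem theorem8 (b : Z) (hb : (2 <= b)%Z) :
  Rbar_le (irrationality_measure (thue_morse_number b)) (Finite 5).
Proof.
  unfold irrationality_measure.
  apply (proj2 (Lub_Rbar_correct _)).
  intros tau [_ Hinf]; simpl.
  destruct (Rle_or_lt tau 5) as [H|Htau]; [exact H|exfalso; apply Hinf].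
  destruct (thue_morse_number_fraction b hb) as [C [HC Hlow]].
  set (xi := thue_morse_number b) in *.
  (* The two summands will bound the numerator and the denominator respectively. *)
  apply Finite_bounded_pairs with (up (C * (Rabs xi + 1) + C)).
  destruct (archimed (C * (Rabs xi + 1) + C)) as [Hup _].
  set (M := up _) in *.
  intros p q [Hq [_ Happ]].
  pose proof (Hlow p q Hq) as Hge.
  assert (Hq1 : 1 <= IZR q) by (apply IZR_le; lia).
  assert (Hq5 : Rpower (IZR q) (- tau) <= / IZR q ^ 5).
  { rewrite <- Rpower_pow by lra; rewrite <- Rpower_Ropp.
    apply Rle_Rpower; simpl; lra. }
  (* Exponent 5 against exponent 4: [q ^ 5 < C * q ^ 4]. *)
  assert (HqC : IZR q < C).
  { assert (Hlt : / (C * IZR q ^ 4) < / IZR q ^ 5) by lra.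
    assert (Hq4 : 0 < IZR q ^ 4) by (apply pow_lt; lra).
    apply Rinv_lt_cancel in Hlt; [|nra].
    simpl in Hlt, Hq4; nra. }
  (* The fraction lies within 1 of [xi], and its denominator is below [C]. *)
  assert (Hxi : Rabs (IZR p) <= C * (Rabs xi + 1)).
  { assert (H1 : / IZR q ^ 5 <= 1).
    { rewrite <- Rinv_1; apply Rinv_le_contravar; [lra|]; apply pow_R1_Rle, Hq1. }
    assert (Hpq : Rabs (IZR p / IZR q) <= Rabs xi + 1).
    { replace (IZR p / IZR q) with (xi + - (xi - IZR p / IZR q)) by ring.
      eapply Rle_trans; [apply Rabs_triang|]; rewrite Rabs_Ropp; lra. }
    replace (IZR p) with (IZR q * (IZR p / IZR q)) by (field; lra).
    rewrite Rabs_mult, (Rabs_right (IZR q)) by lra.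
    apply Rmult_le_compat; try lra; apply Rabs_pos. }
  pose proof (Rabs_pos xi).
  split; apply le_IZR; rewrite abs_IZR; [nra|rewrite Rabs_right; nra].
Qed.
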